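(* For compact Kähler and co-Kähler manifolds, the Hellinger distance is a lower bound on the geodesic distance. That is: let $M$ be a compact Kähler manifold (resp. compact co-Kähler manifold) with metric $g$, viewed for $N$ sufficiently large as an isostatistically embedded submanifold of the open probability simplex $(\Delta^N,g^F,T^{A-C})$, so that each point $p\in M$ is a probability vector $(p_1,\dots,p_{N+1})$. Then for all $p,q\in M$, $$\sqrt{\sum_{i=1}^{N+1}(\sqrt{p_i}-\sqrt{q_i})^2}\;\le\; d_g(p,q),$$ where $d_g$ is the geodesic distance of the Kähler metric (resp. co-Kähler metric) $g$.
   Context: $\Delta^{N}=\{p\in\mathbb{R}^{N+1}:p_i>0,\ \sum_{i=1}^{N+1}p_i=1\}$ is the space of strictly positive probability distributions on a set with $N+1$ elements. The Fisher metric is $g^F_{ij}=E_{p}(\partial_i\log p\,\partial_j\log p)$ and the Amari–Chentsov tensor is $T^{A-C}_{ijk}=E_p(\partial_i\log p\,\partial_j\log p\,\partial_k\log p)$. A smooth embedding $i:(M,g,T)\to(N',h,K)$ between manifolds with a Riemannian metric and a totally symmetric 3-tensor is isostatistical if $g=i^*h$ and $T=i^*K$. On a Kähler (resp. co-Kähler) manifold the tensor used is $T(X,Y,Z)=g(\nabla^*_XY-\nabla_XY,Z)$ for a pair $(\nabla,\nabla^* )$ of torsion-free linear connections that are dual with respect to $g$ (i.e. $X\,g(Y,Z)=g(\nabla_XY,Z)+g(Y,\nabla^*_XZ)$) and satisfy $\nabla\Omega=0$ (resp. $\nabla\Omega=0$, $\nabla E=0$), where $\Omega$ is the Kähler form (resp.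 the structure 2-form). A co-Kähler manifold is $(M^{2d+1},\Omega,\alpha)$ with $\Omega$ a closed 2-form, $\alpha$ a closed 1-form, $\alpha\wedge\Omega^d$ nowhere zero, admitting a compatible almost contact metric structure $(\Theta,E,\alpha,g)$ with $N^{\Theta}=0$. Here $i_E\Omega=0$, $i_E\alpha=1$; $\Theta^2=-I+\alpha\otimes E$, $\Theta E=0$, $\alpha\circ\Theta=0$, $\alpha=g(\cdot,E)$, $g=\Omega(\cdot,\Theta\cdot)+\alpha\otimes\alpha$; and $N^{\Theta}(X,Y)=[\Theta X,\Theta Y]-\Theta[\Theta X,Y]-\Theta[X,\Theta Y]+\Theta^2[X,Y]$. The metric $g$ is called the co-Kähler metric. Manifolds are without boundary. *)

(* Defs.v *)
From HB Require Import structures.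
From mathcomp Require Import all_boot all_order all_algebra all_fingroup.
From mathcomp Require Import all_classical all_reals all_analysis.
From mathcomp Require Import ring.

Set Implicit Arguments.
Unset Strict Implicit.
Unset Printing Implicit Defensive.

Import Order.TTheory GRing.Theory Num.Theory.
Import numFieldNormedType.Exports.

Local Open Scope classical_set_scope.
Local Open Scope ring_scope.

Section SmoothOn.
Context {R : realType} {V W : normedModType R}.

Fixpoint nsmooth_on (k : nat) (U : set V) (f : V -> W) :
    Prop :=
  (forall x, U x -> differentiable f x) /\
  (if k is k'.+1 then forall v, nsmooth_on k' U ('D_v f) else True).

(* All iterated directional derivatives exist and are Frechet differentiable
   on U; for U open and V of finite dimension this is f being C^oo on U. *)
Definition smooth_on (U : set V) (f : V -> W) : Prop :=
  forall k, nsmooth_on k U f.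

Lemma near_eq_differentiable (f g : V -> W) (x : V) :
  (\near x, f x = g x) -> differentiable f x -> differentiable g x.
Proof.
move=> fg /diff_locallyP[cf ef].
have eg : g \o shift x = cst (g x) + 'd f x +o_ 0 id.
  apply/eqaddoP => e e0; move/eqaddoP: ef => /(_ e e0).
  have fgx : f x = g x by exact: nbhs_singleton fg.
  have : \forall y \near (0 : V), f (y + x) = g (y + x).
    by move: fg; rewrite (near_shift 0) subr0.
  apply: filterS2 => y /= gfy.
  by rewrite -[X in _ -> X <= _]/(`|g (y + x) - (g x + 'd f x y)|) -gfy -fgx.
apply/diff_locallyP; have := diff_unique cf eg.
by move=> ->.
Unshelve. all: by end_near. Qed.

Lemma eq_nsmooth_on k (U : set V) (f g : V -> W) :
  open U -> (forall x, U x -> f x = g x) ->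
  nsmooth_on k U f -> nsmooth_on k U g.
Proof.
move=> oU; elim: k f g => [|k IH] f g fg [df Df]; split=> //.
- move=> x Ux; apply: (@near_eq_differentiable f); last exact: df.
  by near=> y; apply: fg; near: y; exact: open_nbhs_nbhs.
- move=> x Ux; apply: (@near_eq_differentiable f); last exact: df.
  by near=> y; apply: fg; near: y; exact: open_nbhs_nbhs.
- move=> v; apply: (IH ('D_v f)); [|exact: Df] => x Ux.
  apply: near_eq_derive.
  by near=> y; apply: fg; near: y; exact: open_nbhs_nbhs.
Unshelve. all: by end_near. Qed.

Lemma nsmooth_on_cst k (U : set V) (a : W) :
  nsmooth_on k U (cst a).
Proof.
elim: k a => [|k IH] a; split=> // v.
rewrite (_ : 'D_v _ = cst 0); first exact: IH.
by apply/funext => x; rewrite derive_cst.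
Qed.

Lemma nsmooth_onD k (U : set V) (f g : V -> W) :
  open U -> nsmooth_on k U f -> nsmooth_on k U g -> nsmooth_on k U (f + g).
Proof.
move=> oU; elim: k f g => [|k IH] f g [df Df] [dg Dg]; split=> //.
- by move=> x Ux; apply: differentiableD; [exact: df|exact: dg].
- by move=> x Ux; apply: differentiableD; [exact: df|exact: dg].
- move=> v; apply: (@eq_nsmooth_on k U ('D_v f + 'D_v g)) => //.
    move=> x Ux; rewrite deriveD //.
      by apply: diff_derivable; exact: df.
    by apply: diff_derivable; exact: dg.
  by apply: IH; [exact: Df|exact: Dg].
Qed.

Lemma nsmooth_onW k (U : set V) (f : V -> W) :
  nsmooth_on k.+1 U f -> nsmooth_on k U f.
Proof.
elim: k f => [|k IH] f [df Df]; split=> // v.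
exact/IH/Df.
Qed.

End SmoothOn.

Lemma nsmooth_onM (R : realType) (V : normedModType R) k (U : set V)
    (f g : V -> R) :
  open U -> nsmooth_on k U f -> nsmooth_on k U g -> nsmooth_on k U (f * g).
Proof.
move=> oU; elim: k f g => [|k IH] f g.
  move=> [df _] [dg _]; split=> // x Ux.
  by apply: differentiableM; [exact: df|exact: dg].
move=> sf sg; have [df Df] := sf; have [dg Dg] := sg; split.
  by move=> x Ux; apply: differentiableM; [exact: df|exact: dg].
move=> v; apply: (@eq_nsmooth_on _ _ _ k U (f * 'D_v g + g * 'D_v f)) => //.
  move=> x Ux; rewrite deriveM //.
    by apply: diff_derivable; exact: df.
  by apply: diff_derivable; exact: dg.
apply: nsmooth_onD => //; apply: IH => //; first
  [exact: nsmooth_onW sf | exact: nsmooth_onW sg | exact: Df | exact: Dg].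
Qed.

Record chart (R : realType) (n : nat) (M : topologicalType) := Chart {
  chart_dom : set M ;
  chart_fun :> M -> 'rV[R]_n ;
  chart_inv : 'rV[R]_n -> M ;
  chart_dom_open : open chart_dom ;
  chart_img_open : open (chart_fun @` chart_dom) ;
  chartK : forall x, chart_dom x -> chart_inv (chart_fun x) = x ;
  chart_cont : forall x, chart_dom x -> {for x, continuous chart_fun} ;
  chart_inv_cont : forall x, chart_dom x -> {for chart_fun x, continuous chart_inv} }.

(* Smooth manifolds without boundary; the atlas need not be maximal. *)
Record manifold (R : realType) (n : nat) := Manifold {
  mfd_sort :> topologicalType ;
  atlas : set (chart R n mfd_sort) ;
  mfd_hausdorff : hausdorff_space mfd_sort ;
  mfd_second_countable : @second_countable mfd_sort ;
  atlas_cover : forall x : mfd_sort, exists2 c, atlas c & chart_dom c x ;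
  atlas_compat : forall c c', atlas c -> atlas c' ->
    smooth_on (c @` (chart_dom c `&` chart_dom c')) (c' \o chart_inv c) }.

Section SmoothFunctions.
Context {R : realType} {n : nat} (M : manifold R n).

Definition smooth (f : M -> R) : Prop :=
  forall c, atlas c -> smooth_on (c @` chart_dom c) (f \o chart_inv c).

Definition smooth_pred : pred (M -> R) := fun f => `[< smooth f >].

Lemma smooth_subring : subring_closed smooth_pred.
Proof.
have sD f g : smooth f -> smooth g -> smooth (f + g).
  move=> sf sg c ac k; apply: (@nsmooth_onD _ _ _ _ _ (f \o chart_inv c)).
  - exact: chart_img_open.
  - exact: sf.
  - exact: sg.
have sM f g : smooth f -> smooth g -> smooth (f * g).
  move=> sf sg c ac k; apply: (@nsmooth_onM _ _ _ _ (f \o chart_inv c)).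
  - exact: chart_img_open.
  - exact: sf.
  - exact: sg.
have sC a : smooth (cst a) by move=> c ac k; exact: nsmooth_on_cst.
split=> [|f g /asboolP sf /asboolP sg|f g /asboolP sf /asboolP sg].
- exact/asboolP/sC.
- apply/asboolP/sD => //.
  rewrite (_ : - g = cst (-1) * g); first exact: sM.
  by apply/funext => x; rewrite /cst/= -[LHS]/(- g x) -[RHS]/(-1 * g x) mulN1r.
- exact/asboolP/sM.
Qed.

HB.instance Definition _ :=
  GRing.isSubringClosed.Build (M -> R) smooth_pred smooth_subring.

Lemma smooth_submod : submod_closed (smooth_pred : {pred (M -> R)}).
Proof.
split=> [|a f g sf sg]; first exact: rpred0.
have sa : cst a \in smooth_pred.
  by apply/asboolP => c ac k; exact: nsmooth_on_cst.
exact: (rpredD (rpredM sa sf) sg).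
Qed.

HB.instance Definition _ :=
  GRing.isSubmodClosed.Build R (M -> R) smooth_pred smooth_submod.

Record smooth_fun := SmoothFun {
  sfun :> M -> R ; sfunP : sfun \in smooth_pred }.
HB.instance Definition _ := [isSub for sfun].
HB.instance Definition _ := [Choice of smooth_fun by <:].
HB.instance Definition _ := 
  GRing.SubChoice_isSubComPzRing.Build _ _ smooth_fun smooth_subring.
HB.instance Definition _ := [SubZmodule_isSubLmodule of smooth_fun by <:].

End SmoothFunctions.

Arguments smooth {R n M}.
Arguments smooth_pred {R n} M _ : rename.
Notation "'C^oo' M" := (smooth_fun M) (at level 10, M at level 8) : type_scope.

Section Tangent.
Context {R : realType} {n : nat} {M : manifold R n}.
Implicit Types (p : M) (f h : C^oo M).

(* The tangent space at p: R-linear derivations at p of the algebra C^oo M. *)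
Definition derivation_at p : pred (C^oo M -> R) := fun v =>
  `[< (forall (a : R) f h, v (a *: f + h) = a * v f + v h) /\
      (forall f h, v (f * h) = f p * v h + h p * v f) >].

Lemma derivation_at_submod p :
  submod_closed (derivation_at p : {pred (C^oo M -> R)}).
Proof.
split=> [|a v w /asboolP[v1 v2] /asboolP[w1 w2]]; apply/asboolP; split.
- by move=> a f h; rewrite /= mulr0 addr0.
- by move=> f h; rewrite /= !mulr0 addr0.
- move=> b f h; rewrite -![(a *: v + w) _]/(a * v _ + w _) v1 w1; ring.
- move=> f h; rewrite -![(a *: v + w) _]/(a * v _ + w _) v2 w2; ring.
Qed.

HB.instance Definition _ p :=
  GRing.isSubmodClosed.Build R (C^oo M -> R) (derivation_at p)
    (derivation_at_submod p).

Record tangent p := Tangent {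
  tangent_fun :> C^oo M -> R ; tangentP : tangent_fun \in derivation_at p }.
HB.instance Definition _ p := [isSub for @tangent_fun p].
HB.instance Definition _ p := [Choice of tangent p by <:].
HB.instance Definition _ p := [SubChoice_isSubLmodule of tangent p by <:].

(* Smooth vector fields: R-linear derivations of the algebra C^oo M, viewed as
   a submodule of the C^oo M-module of all maps C^oo M -> C^oo M. *)
Definition derivation : pred (C^oo M -> (C^oo M)^o) := fun X =>
  `[< (forall (a : R) f h, X (a *: f + h) = (a *: (X f : C^oo M) + X h)) /\
      (forall f h, X (f * h) = f * X h + h * X f) >].

Lemma derivation_submod :
  submod_closed (derivation : {pred (C^oo M -> (C^oo M)^o)}).
Proof.
split=> [|k X Y /asboolP[X1 X2] /asboolP[Y1 Y2]]; apply/asboolP; split.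
- by move=> a f h; rewrite /= scaler0 addr0.
- by move=> f h; rewrite /= !mulr0 addr0.
- move=> a f h; rewrite -![(k *: X + Y) _]/(k * X _ + Y _) X1 Y1.
  apply/val_inj/funext => x.
  rewrite -[LHS]/(k x * (a * X f x + X h x) + (a * Y f x + Y h x)).
  rewrite -[RHS]/(a * (k x * X f x + Y f x) + (k x * X h x + Y h x)); ring.
- move=> f h; rewrite -![(k *: X + Y) _]/(k * X _ + Y _) X2 Y2; ring.
Qed.

HB.instance Definition _ :=
  GRing.isSubmodClosed.Build (C^oo M) (C^oo M -> (C^oo M)^o) derivation
    derivation_submod.

Record vfield := VField {
  vfield_fun :> C^oo M -> (C^oo M)^o ; vfieldP : vfield_fun \in derivation }.
HB.instance Definition _ := [isSub for vfield_fun].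
HB.instance Definition _ := [Choice of vfield by <:].
HB.instance Definition _ := [SubChoice_isSubLmodule of vfield by <:].
Implicit Types X Y Z : vfield.

Lemma vfield_at_subproof X p : (fun f => X f p) \in derivation_at p.
Proof.
have [X1 X2] := asboolW (vfieldP X).
by apply/asboolP; split=> [a f h|f h]; rewrite ?X1 ?X2.
Qed.

Definition vfield_at X p : tangent p := Tangent (vfield_at_subproof X p).

Lemma bracket_subproof X Y : (fun f => X (Y f) - Y (X f)) \in derivation.
Proof.
have [X1 X2] := asboolW (vfieldP X); have [Y1 Y2] := asboolW (vfieldP Y).
apply/asboolP; split=> [a f h|f h].
  by rewrite !(X1, Y1) scalerBr opprD addrACA.
have XD u v : X (u + v) = X u + X v by rewrite -[u]scale1r X1 !scale1r.
have YD u v : Y (u + v) = Y u + Y v by rewrite -[u]scale1r Y1 !scale1r.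
rewrite X2 Y2 XD YD !X2 !Y2; ring.
Qed.

Definition bracket X Y : vfield := VField (bracket_subproof X Y).
End Tangent.

Arguments tangent {R n} M p.
Arguments vfield {R n} M.

Section Tensors.
Context {R : realType} {n : nat} (M : manifold R n).

Record one_form := OneForm {
  form1 :> forall p, tangent M p -> R ;
  form1_lin : forall p (a : R) (v w : tangent M p),
    form1 (a *: v + w) = a * form1 v + form1 w ;
  form1_smooth : forall X : vfield M,
    (fun p => form1 (vfield_at X p)) \in smooth_pred M }.

(* Smooth covariant 2-tensor fields, with no symmetry assumed. *)
Record tensor2 := Tensor2 {
  tens2 :> forall p, tangent M p -> tangent M p -> R ;
  tens2_linl : forall p (a : R) (u v w : tangent M p),
    tens2 (a *: u + v) w = a * tens2 u w + tens2 v w ;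
  tens2_linr : forall p (a : R) (u v w : tangent M p),
    tens2 w (a *: u + v) = a * tens2 w u + tens2 w v ;
  tens2_smooth : forall X Y : vfield M,
    (fun p => tens2 (vfield_at X p) (vfield_at Y p)) \in smooth_pred M }.

Record endo_field := EndoField {
  endo :> forall p, tangent M p -> tangent M p ;
  endo_lin : forall p (a : R) (v w : tangent M p),
    endo (a *: v + w) = a *: endo v + endo w ;
  endo_smooth : forall (X : vfield M) (f : C^oo M),
    (fun p => endo (vfield_at X p) f) \in smooth_pred M }.

Definition app1 (alpha : one_form) (X : vfield M) : C^oo M :=
  SmoothFun (form1_smooth alpha X).

Definition app2 (w : tensor2) (X Y : vfield M) : C^oo M :=
  SmoothFun (tens2_smooth w X Y).

Lemma endo_app_subproof (T : endo_field) (X : vfield M) :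
  (fun f => SmoothFun (endo_smooth T X f) : (C^oo M)^o) \in derivation (M := M).
Proof.
apply/asboolP; split=> [a f h|f h]; apply/val_inj/funext => p /=;
  have [v1 v2] := asboolW (tangentP (T p (vfield_at X p))).
- exact: v1.
- exact: v2.
Qed.

Definition endo_app (T : endo_field) (X : vfield M) : vfield M :=
  VField (endo_app_subproof T X).

Definition alternating (w : tensor2) : Prop :=
  forall p (v : tangent M p), w p v v = 0.

Definition closed1 (alpha : one_form) : Prop := forall X Y : vfield M,
  X (app1 alpha Y) - Y (app1 alpha X) - app1 alpha (bracket X Y) = 0.

Definition closed2 (w : tensor2) : Prop := forall X Y Z : vfield M,
  X (app2 w Y Z) - Y (app2 w X Z) + Z (app2 w X Y)
  - app2 w (bracket X Y) Z + app2 w (bracket X Z) Y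
  - app2 w (bracket Y Z) X = 0.

(* alpha /\ w^d at p on 2d+1 vectors, up to a positive constant factor. *)
Definition wedge_top (alpha : one_form) (w : tensor2) (d : nat) (p : M)
    (v : 'I_(d.*2.+1) -> tangent M p) : R :=
  \sum_(s : 'S_(d.*2.+1)) (-1) ^+ s * alpha p (v (s ord0)) *
    \prod_(i < d) w p (v (s (inord i.*2.+1))) (v (s (inord i.*2.+2))).

Definition riemannian (g : tensor2) : Prop :=
  (forall p (v w : tangent M p), g p v w = g p w v) /\
  (forall p (v : tangent M p), v != 0 -> 0 < g p v v).

Definition nijenhuis (T : endo_field) (X Y : vfield M) : vfield M :=
  let TT := endo_app T in
  bracket (TT X) (TT Y) - TT (bracket (TT X) Y) - TT (bracket X (TT Y))
  + TT (TT (bracket X Y)).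

Record connection := Connection {
  nabla :> vfield M -> vfield M -> vfield M ;
  nabla_linl : forall (f : C^oo M) X X' Y,
    nabla (f *: X + X') Y = f *: nabla X Y + nabla X' Y ;
  nablaDr : forall X Y Y', nabla X (Y + Y') = nabla X Y + nabla X Y' ;
  nabla_leibniz : forall (f : C^oo M) X Y,
    nabla X (f *: Y) = (X f : C^oo M) *: Y + f *: nabla X Y }.

Definition torsion_free (D : connection) : Prop :=
  forall X Y, D X Y - D Y X = bracket X Y.

Definition dual_connections (g : tensor2) (D D' : connection) : Prop :=
  forall X Y Z : vfield M,
    X (app2 g Y Z) = app2 g (D X Y) Z + app2 g Y (D' X Z).

Definition parallel2 (D : connection) (w : tensor2) : Prop :=
  forall X Y Z : vfield M,
    X (app2 w Y Z) = app2 w (D X Y) Z + app2 w Y (D X Z).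

Definition parallel_vfield (D : connection) (E : vfield M) : Prop :=
  forall X, D X E = 0.

Definition stat_tensor (g : tensor2) (D D' : connection) (X Y Z : vfield M) :
    C^oo M := app2 g (D' X Y - D X Y) Z.

End Tensors.

(* Integrability of J is the vanishing of its Nijenhuis tensor; Omega is
   nondegenerate because g is. *)
Record kahler (R : realType) (d : nat) (M : manifold R d.*2)
    (Omega : tensor2 M) (J : endo_field M) (g : tensor2 M) : Prop := Kahler {
  kahler_alt : alternating Omega ;
  kahler_closed : closed2 Omega ;
  kahler_metric : riemannian g ;
  kahler_J2 : forall X, endo_app J (endo_app J X) = - X ;
  kahler_integrable : forall X Y, nijenhuis J X Y = 0 ;
  kahler_compat : forall X Y, app2 g X Y = app2 Omega X (endo_app J Y) }.

Record cokahler (R : realType) (d : nat) (M : manifold R d.*2.+1)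
    (Omega : tensor2 M) (alpha : one_form M) (Theta : endo_field M)
    (E : vfield M) (g : tensor2 M) : Prop := CoKahler {
  cokahler_alt : alternating Omega ;
  cokahler_closed2 : closed2 Omega ;
  cokahler_closed1 : closed1 alpha ;
  cokahler_volume : forall p : M, exists v : 'I_(d.*2.+1) -> tangent M p,
    wedge_top alpha Omega v != 0 ;
  cokahler_metric : riemannian g ;
  cokahler_iEOmega : forall X, app2 Omega E X = 0 ;
  cokahler_iEalpha : app1 alpha E = 1 ;
  cokahler_Theta2 : forall X,
    endo_app Theta (endo_app Theta X) = - X + app1 alpha X *: E ;
  cokahler_ThetaE : endo_app Theta E = 0 ;
  cokahler_alphaTheta : forall X, app1 alpha (endo_app Theta X) = 0 ;
  cokahler_alphaE : forall X, app1 alpha X = app2 g X E ;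
  cokahler_compat : forall X Y, app2 g X Y =
    app2 Omega X (endo_app Theta Y) + app1 alpha X * app1 alpha Y ;
  cokahler_normal : forall X Y, nijenhuis Theta X Y = 0 }.

Section Curves.
Context {R : realType} {n : nat} {M : manifold R n}.

Record curve := Curve {
  curve_fun :> R -> M ;
  curve_cont : continuous curve_fun ;
  curve_smooth : forall c, atlas c ->
    smooth_on (curve_fun @^-1` chart_dom c) (c \o curve_fun) }.

Lemma curve_derivable (s : curve) (f : C^oo M) (t : R) :
  derivable (f \o s) t 1.
Proof.
have [c ac dt] := atlas_cover (s t).
have oV : open (s @^-1` chart_dom c).
  by move/continuousP: (@curve_cont s); apply; exact: chart_dom_open.
have ds : differentiable (c \o s) t.
  by have [+ _] := curve_smooth s ac 0; apply.
have df : differentiable (f \o chart_inv c) ((c \o s) t).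
  have /asboolP/(_ c ac 0)[+ _] := sfunP f; apply.
  by exists (s t).
apply: diff_derivable.
apply: near_eq_differentiable (differentiable_comp ds df).
apply: filterS (open_nbhs_nbhs (conj oV dt)) => u su.
exact: (congr1 f (chartK su)).
Qed.

Lemma velocity_subproof (s : curve) (t : R) :
  (fun f : C^oo M => 'D_1 (f \o s) t) \in derivation_at (s t).
Proof.
apply/asboolP; split=> [a f h|f h];
  have df := @curve_derivable s f t; have dh := @curve_derivable s h t.
- have -> : (a *: f + h : C^oo M) \o s = (a \*: (f \o s)) + (h \o s).
    by apply/funext.
  have da : derivable (a \*: (f \o s)) t 1 by exact: derivableZ df.
  by rewrite (deriveD da dh) (deriveZ _ df).
- have -> : (f * h : C^oo M) \o s = (f \o s) * (h \o s) by apply/funext.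
  by rewrite (deriveM df dh).
Qed.

Definition velocity (s : curve) (t : R) : tangent M (s t) :=
  Tangent (velocity_subproof s t).

Definition curve_length (g : tensor2 M) (s : curve) : \bar R :=
  (\int[lebesgue_measure]_(t in `[0%R, 1%R])
     (Num.sqrt (g _ (velocity s t) (velocity s t)))%:E)%E.

(* piecewise_smooth_path g p q l: l is the length of some piecewise smooth path
   from p to q, each piece being parametrized by [0, 1]. *)
Inductive piecewise_smooth_path (g : tensor2 M) : M -> M -> \bar R -> Prop :=
| path_nil p : piecewise_smooth_path g p p 0%E
| path_cons (s : curve) q l : piecewise_smooth_path g (s 1) q l ->
    piecewise_smooth_path g (s 0) q (curve_length g s + l)%E.

(* M need not be connected: the distance is +oo between two components. *)
Definition geodesic_distance (g : tensor2 M) (p q : M) : \bar R :=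
  ereal_inf [set l | piecewise_smooth_path g p q l].

End Curves.

Arguments curve {R n} M.

Section Simplex.
Context {R : realType} {N : nat}.
Implicit Types (p q u v w : 'rV[R]_N.+1).

Definition simplex : set 'rV[R]_N.+1 :=
  [set p | (forall k, 0 < p 0 k) /\ \sum_k p 0 k = 1].

Definition expect p (F : 'I_N.+1 -> R) : R := \sum_k p 0 k * F k.

Definition dlog p u (k : 'I_N.+1) : R :=
  'D_u (fun x : 'rV[R]_N.+1 => ln (x 0 k)) p.

(* The tangent vectors of the simplex are the u with \sum_k u 0 k = 0. *)
Definition fisher p u v : R := expect p (fun k => dlog p u k * dlog p v k).

Definition amari_chentsov p u v w : R :=
  expect p (fun k => dlog p u k * dlog p v k * dlog p w k).

Definition hellinger p q : R :=
  Num.sqrt (\sum_k (Num.sqrt (p 0 k) - Num.sqrt (q 0 k)) ^+ 2).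

End Simplex.

Section Embedding.
Context {R : realType} {n N : nat} (M : manifold R n).

(* The simplex is a submanifold of 'rV[R]_N.+1, so smoothness and topology are
   those of the ambient space. *)
Record simplex_map := SimplexMap {
  smap :> M -> 'rV[R]_N.+1 ;
  smap_simplex : forall x, simplex (smap x) ;
  smap_smooth : forall k, (fun x => smap x 0 k) \in smooth_pred M }.

Definition smap_coord (i : simplex_map) (k : 'I_N.+1) : C^oo M :=
  SmoothFun (smap_smooth i k).

Definition pushforward (i : simplex_map) p (v : tangent M p) : 'rV[R]_N.+1 :=
  \row_k v (smap_coord i k).

(* An injective immersion which is a homeomorphism onto its image. *)
Definition smooth_embedding (i : simplex_map) : Prop :=
  [/\ injective i, continuous i,
      forall U : set M, open U ->
        exists2 V : set 'rV[R]_N.+1, open V & i @` U = range i `&` V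
    & forall p, injective (@pushforward i p)].

Definition isostatistical (g : tensor2 M) (D D' : connection M)
    (i : simplex_map) : Prop :=
  [/\ smooth_embedding i,
      forall p (v w : tangent M p),
        g p v w = fisher (i p) (pushforward i v) (pushforward i w)
    & forall (X Y Z : vfield M) p,
        stat_tensor g D D' X Y Z p =
        amari_chentsov (i p) (pushforward i (vfield_at X p))
          (pushforward i (vfield_at Y p)) (pushforward i (vfield_at Z p))].

End Embedding.

Arguments simplex_map {R n} N M.

(* Main.v *)
Require Import Defs.
From mathcomp Require Import all_boot all_order all_algebra.
From mathcomp Require Import all_classical all_reals all_analysis.
From mathcomp Require Import ring lra.

Import Order.TTheory GRing.Theory Num.Theory.
Import numFieldNormedType.Exports.

(** An isostatistical embedding makes [g] the pullback of the Fisher metric.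
On the simplex the Fisher metric is [\sum_k dp_k^2 / p_k], which equals
[4 \sum_k (d (sqrt p_k))^2]: the map [p |-> (sqrt p_k)_k] multiplies lengths by
1/2, so a path in the manifold is sent to a path of half its length in
Euclidean space, and the Hellinger distance is the length of the chord joining
the endpoints of that image.

To compare the chord with the length, the path is tested against one
linear form at a time.  If [w] is a vector of Euclidean norm at most 1, then
[\sum_k w_k sqrt p_k] has, along a curve, a derivative bounded by the speed
([sqr_dot_le] is the Cauchy-Schwarz inequality used here), so its variation is
at most the length of the curve ([dot_sqrt_le_curve_length]).  Such variations
add up over the pieces of a path ([dot_sqrt_le_path_length]), and the choice of
[w] as the unit vector in the direction of the chord turns the total variation
into the Hellinger distance.

The fundamental theorem of calculus and the monotonicity of the integral need
the derivative and the speed to be continuous; this comes from the chain rule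
in a chart ([curve_continuous_derive]). *)

Section HellingerBound.
Set Implicit Arguments.
Unset Strict Implicit.
Local Open Scope classical_set_scope.
Local Open Scope ring_scope.

(** * Cauchy-Schwarz and the Fisher metric in coordinates *)

Lemma sqr_dot_le (R : realDomainType) (n : nat) (w y : 'I_n -> R) :
  (\sum_k w k * y k) ^+ 2 <= (\sum_k w k ^+ 2) * (\sum_k y k ^+ 2).
Proof.
set P := \sum_k w k * y k; set W := \sum_k w k ^+ 2.
set Y := \sum_k y k ^+ 2.
have W0 : 0 <= W by apply: sumr_ge0 => k _; exact: sqr_ge0.
(* The quadratic form behind the discriminant proof, taken at
   (W, - P) to avoid divisions; it settles the case 0 < W. *)
have eW : \sum_k (W * y k - P * w k) ^+ 2 = W * (W * Y - P ^+ 2).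
  rewrite (eq_bigr (fun k => W ^+ 2 * y k ^+ 2 + (- (2 * W * P)) * (w k * y k)
    + P ^+ 2 * w k ^+ 2)); last by move=> k _; ring.
  by rewrite !big_split/= -!mulr_sumr -/P -/W -/Y; ring.
have : 0 <= W * (W * Y - P ^+ 2).
  by rewrite -eW; apply: sumr_ge0 => k _; exact: sqr_ge0.
have [W_gt0|] := ltP 0 W; first by rewrite pmulr_rge0// subr_ge0.
rewrite le_eqVlt ltNge W0 orbF => /eqP W00 _.
have w0 k : w k = 0.
  have /psumr_eq0P := W00; move=> /(_ (fun _ _ => sqr_ge0 _))/(_ k isT) /eqP.
  by rewrite sqrf_eq0 => /eqP.
by rewrite W00 mul0r /P big1 ?expr0n// => k _; rewrite w0 mul0r.
Qed.

(** The line through [p] directed by [u] reduces this to a derivative in one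
variable. *)
Lemma dlogE (R : realType) (N : nat) (p u : 'rV[R]_N.+1) (k : 'I_N.+1) :
  0 < p 0 k -> dlog p u k = u 0 k / p 0 k.
Proof.
move=> pk; pose h (t : R) := t * u 0 k + p 0 k.
have h0 : h 0 = p 0 k by rewrite /h mul0r add0r.
have dh : is_derive (0 : R) 1 h (u 0 k).
  rewrite (_ : h = (u 0 k \*: id) + cst (p 0 k)).
    by apply: is_derive_eq; rewrite addr0 -[LHS]/(u 0 k * 1) mulr1.
  by apply/funext => t; rewrite /h mulrC.
have dln : is_derive (h 0) 1 (@ln R) (p 0 k)^-1.
  by rewrite h0; exact: is_derive1_ln pk.
have [_ lnh] := is_derive1_comp dln dh.
rewrite mulrC -lnh /dlog /derive.
set F := (F in F @ _); set G := (G in _ = lim (G @ _)).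
rewrite (_ : F = G)//; apply/funext => t; rewrite /F /G/= h0.
by rewrite /h !mxE addr0 -[_%:A]/(t * 1) mulr1.
Qed.

Lemma fisherE (R : realType) (N : nat) (p u v : 'rV[R]_N.+1) :
  simplex p -> fisher p u v = \sum_k u 0 k * v 0 k / p 0 k.
Proof.
move=> [p0 _]; apply: eq_bigr => k _; rewrite !dlogE//.
by field; rewrite gt_eqF.
Qed.

(** * Regularity of functions along curves *)

(** By the chain rule the derivative is a finite sum of products of components
of the velocity with partial derivatives, each of which is differentiable, hence
continuous, when both maps are differentiable to order 2. *)
Lemma continuous_derive_comp (R : realType) (n : nat) (U : set 'rV[R]_n)
    (f : 'rV[R]_n -> R) (c : R -> 'rV[R]_n) (V : set R) (t : R) :
  open V -> V t -> (forall r, V r -> U (c r)) ->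
  nsmooth_on 1 V c -> nsmooth_on 1 U f ->
  {for t, continuous (fun r => 'D_1 (f \o c) r)}.
Proof.
move=> oV Vt VU [dc Dc] [df Df].
have [ddc _] := Dc 1.
have E r : V r ->
   'D_1 (f \o c) r = \sum_j ('D_1 c r) 0 j * 'D_(delta_mx 0 j) f (c r).
  move=> Vr; have dcr := dc _ Vr; have dfc := df _ (VU _ Vr).
  rewrite deriveE; last exact: differentiable_comp.
  rewrite diff_comp//= (deriveE _ dcr).
  rewrite {1}(matrix_sum_delta ('d c r 1)) big_ord1.
  rewrite linear_sum/=; apply: eq_bigr => j _.
  by rewrite linearZ/= deriveE.
pose G r := \sum_j ('D_1 c r) 0 j * 'D_(delta_mx 0 j) f (c r).
have EG : {near t, G =1 (fun r => 'D_1 (f \o c) r)}.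
  by near=> r; rewrite E//; near: r; exact: open_nbhs_nbhs.
rewrite /prop_for /continuous_at E// -/(G t).
apply: (cvg_trans (near_eq_cvg EG)).
apply: cvg_big => [|j _]; first exact: add_continuous.
  apply: cvgM.
  have := differentiable_continuous (ddc _ Vt).
  move=> dct; apply: (@continuous_comp _ _ _ ('D_1 c)
    (fun A : 'rV[R]_n => A 0 j) t dct).
  exact: coord_continuous.
have [+ _] := Df (delta_mx 0 j).
move=> /(_ _ (VU _ Vt))/differentiable_continuous.
have := differentiable_continuous (dc _ Vt).
exact: continuous_comp.
Unshelve. all: by end_near. Qed.

(** Near each parameter the curve stays in one chart, through which [f \o s]
factors. *)
Lemma curve_continuous_derive (R : realType) (n : nat) (M : manifold R n)
  (f : smooth_fun M) (s : curve M) : continuous (fun t => 'D_1 (f \o s) t).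
Proof.
move=> t; have [c ac dt] := atlas_cover (s t).
pose V := s @^-1` chart_dom c.
have oV : open V.
  by move/continuousP: (@curve_cont _ _ _ s); apply; exact: chart_dom_open.
have sf : smooth f by apply/asboolP/sfunP.
have E r : V r -> \near r, f (s r) = ((f \o chart_inv c) \o (c \o s)) r.
  move=> Vr; near=> u; rewrite /= chartK//; near: u.
  exact: (open_nbhs_nbhs (conj oV Vr)).
have ct :
    {for t, continuous (fun r => 'D_1 ((f \o chart_inv c) \o (c \o s)) r)}.
  apply: (@continuous_derive_comp _ _ (c @` chart_dom c) _ _ V) => //.
  - by move=> r Vr; exists (s r).
  - exact: (curve_smooth s ac 1).
  - exact: (sf c ac 1).
have e r : V r -> 'D_1 ((f \o chart_inv c) \o (c \o s)) r = 'D_1 (f \o s) r.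
  by move=> Vr; apply/esym/near_eq_derive; exact: E.
rewrite /continuous_at -e//; apply: cvg_trans ct; apply: near_eq_cvg.
by near=> r; apply: e; near: r; exact: (open_nbhs_nbhs (conj oV dt)).
Unshelve. all: by end_near. Qed.


(** * Length of curves for a metric pulled back from the simplex *)

Section FisherMetric.
Variables (R : realType) (n N : nat) (M : manifold R n).
Variables (g : tensor2 M) (i : simplex_map N M).
Hypothesis g_fisher : forall p (v w : tangent M p),
  g p v w = fisher (i p) (Defs.pushforward i v) (Defs.pushforward i w).

Let x (s : curve M) k t : R := i (s t) 0 k.

Let x_gt0 s k t : 0 < x s k t.
Proof. by have [+ _] := smap_simplex i (s t); apply. Qed.

Let continuous_x s k : continuous (x s k).
Proof.
move=> t; apply/differentiable_continuous/derivable1_diffP.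
exact: (@curve_derivable _ _ _ s (smap_coord i k) t).
Qed.

Let continuous_dx s k : continuous (fun t => 'D_1 (x s k) t).
Proof. exact: (@curve_continuous_derive _ _ _ (smap_coord i k)). Qed.

Lemma fisher_speedE (s : curve M) t :
  g _ (velocity s t) (velocity s t) =
  \sum_k ('D_1 (fun r => i (s r) 0 k) t) ^+ 2 / i (s t) 0 k.
Proof.
rewrite g_fisher fisherE; last exact: smap_simplex.
by apply: eq_bigr => k _; rewrite !mxE -expr2.
Qed.

Lemma continuous_speed (s : curve M) :
  continuous (fun t => Num.sqrt (g _ (velocity s t) (velocity s t))).
Proof.
move=> t; under eq_fun do rewrite fisher_speedE.
apply: (@continuous_comp _ _ _ _ Num.sqrt); last exact: sqrt_continuous.
apply: cvg_big => [|k _]; first exact: add_continuous.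
  apply: cvgM.
  by apply: cvgM; exact: continuous_dx.
apply: cvgV; last exact: continuous_x.
by rewrite gt_eqF// x_gt0.
Qed.

(** The derivative of [\sum_k w_k sqrt x_k] is [\sum_k w_k x_k' / (2 sqrt x_k)],
and [\sum_k (x_k' / (2 sqrt x_k))^2] is a quarter of the squared speed. *)
Lemma dot_sqrt_le_curve_length (s : curve M) (w : 'I_N.+1 -> R) :
  \sum_k w k ^+ 2 <= 1 ->
  ((\sum_k w k * (Num.sqrt (i (s 1) 0 k) - Num.sqrt (i (s 0) 0 k)))%:E
    <= curve_length g s)%E.
Proof.
move=> w1.
pose Phi := \sum_k (w k \*: (Num.sqrt \o x s k)).
pose dPhi t := \sum_k w k * ((2 * Num.sqrt (x s k t))^-1 * 'D_1 (x s k) t).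
have dPhiP (t : R) : is_derive t 1 Phi (dPhi t).
  apply: is_derive_sum => k; apply: is_deriveZ.
  apply: is_derive1_comp; first exact: is_derive1_sqrt (x_gt0 _ _ _).
  apply: DeriveDef => //.
  exact: (@curve_derivable _ _ _ s (smap_coord i k) t).
have cPhi : continuous Phi.
  move=> t; apply/differentiable_continuous/derivable1_diffP.
  by have [] := dPhiP t.
have cdPhi : continuous dPhi.
  move=> t; apply: cvg_big => [|k _]; first exact: add_continuous.
  apply: cvgM; first exact: cvg_cst.
  apply: cvgM; last exact: continuous_dx.
  apply: cvgV; first by rewrite mulf_neq0// gt_eqF// sqrtr_gt0 x_gt0.
  apply: cvgM; first exact: cvg_cst.
  apply: (@continuous_comp _ _ _ (x s k)); first exact: continuous_x.
  exact: sqrt_continuous.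
have FTC : (\int[lebesgue_measure]_(t in `[0%R, 1%R]) (dPhi t)%:E
    = (Phi 1)%:E - (Phi 0)%:E)%E.
  apply: continuous_FTC2 => //.
  - exact: continuous_subspaceT.
  - split; first by move=> t _; have [] := dPhiP t.
    + exact/cvg_at_right_filter/cPhi.
    + exact/cvg_at_left_filter/cPhi.
  - by move=> t _; rewrite derive1E; have [] := dPhiP t.
have PhiE t : Phi t = \sum_k w k * Num.sqrt (i (s t) 0 k).
  by rewrite /Phi fct_sumE.
have -> : \sum_k w k * (Num.sqrt (i (s 1) 0 k) - Num.sqrt (i (s 0) 0 k))
    = Phi 1 - Phi 0.
  by rewrite !PhiE -sumrB; apply: eq_bigr => k _; rewrite mulrBr.
rewrite EFinB -FTC; apply: le_integral => //.
- apply: continuous_compact_integrable; first exact: segment_compact.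
  exact: continuous_subspaceT.
- apply: continuous_compact_integrable; first exact: segment_compact.
  exact/continuous_subspaceT/continuous_speed.
- move=> t _; rewrite lee_fin fisher_speedE (le_trans (ler_norm _))//.
  rewrite -sqrtr_sqr ler_wsqrtr// (le_trans (sqr_dot_le _ _))//.
  set Y := \sum_k _ ^+ 2 / _.
  have Y0 : 0 <= Y.
    by apply: sumr_ge0 => k _; rewrite divr_ge0 ?sqr_ge0// ltW// x_gt0.
  have -> : \sum_k ((2 * Num.sqrt (x s k t))^-1 * 'D_1 (x s k) t) ^+ 2
      = 4^-1 * Y.
    rewrite mulr_sumr; apply: eq_bigr => k _.
    rewrite exprMn exprVn exprMn sqr_sqrtr; last exact/ltW/x_gt0.
    rewrite -/(x s k t); field.
    by rewrite gt_eqF// x_gt0.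
  apply: (@le_trans _ _ (4^-1 * Y)).
    by rewrite ler_piMl// mulr_ge0.
  by rewrite ler_piMl// invf_le1//; lra.
Qed.

(** The vector [w] is the same for all pieces, so that the variations telescope:
the pieces are summed before the norm of the chord is taken. *)
Lemma dot_sqrt_le_path_length (w : 'I_N.+1 -> R) p q l :
  \sum_k w k ^+ 2 <= 1 -> piecewise_smooth_path g p q l ->
  ((\sum_k w k * (Num.sqrt (i q 0 k) - Num.sqrt (i p 0 k)))%:E <= l)%E.
Proof.
move=> w1; elim=> {p q l} [p|s q l _ IH].
  by rewrite big1// => k _; rewrite subrr mulr0.
rewrite [X in X%:E](_ : _ =
  \sum_k w k * (Num.sqrt (i (s 1) 0 k) - Num.sqrt (i (s 0) 0 k)) +
  \sum_k w k * (Num.sqrt (i q 0 k) - Num.sqrt (i (s 1) 0 k))).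
  by rewrite EFinD leeD// dot_sqrt_le_curve_length.
by rewrite -big_split/=; apply: eq_bigr => k _; ring.
Qed.

(** The chord is tested against its own direction [u / H]. *)
Lemma hellinger_le_geodesic_distance (p q : M) :
  ((hellinger (i p) (i q))%:E <= geodesic_distance g p q)%E.
Proof.
apply: le_ereal_inf_tmp => l pql.
set H := hellinger _ _; pose u k := Num.sqrt (i q 0 k) - Num.sqrt (i p 0 k).
have HE : H ^+ 2 = \sum_k u k ^+ 2.
  rewrite sqr_sqrtr; last by apply: sumr_ge0 => k _; exact: sqr_ge0.
  by apply: eq_bigr => k _; rewrite /u -opprB sqrrN.
(* The convention x / 0 = 0 makes u / H the zero vector when H = 0, which is
   still an admissible test vector. *)
have w1 : \sum_k (u k / H) ^+ 2 <= 1.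
  under eq_bigr do rewrite expr_div_n.
  rewrite -mulr_suml -HE; have [->|H0] := eqVneq H 0.
    by rewrite expr0n mul0r.
  by rewrite divff// sqrf_eq0.
have := dot_sqrt_le_path_length w1 pql.
rewrite (_ : \sum_k _ = H)//.
transitivity ((\sum_k u k ^+ 2) / H).
  by rewrite mulr_suml; apply: eq_bigr => k _; rewrite -/(u k); ring.
by rewrite -HE; have [->|H0] := eqVneq H 0; [rewrite invr0 mulr0|field].
Qed.

End FisherMetric.
End HellingerBound.

Theorem corollary6p18 (R : realType) :
  (forall (d N : nat) (M : manifold R d.*2) (Omega : tensor2 M)
      (J : endo_field M) (g : tensor2 M) (D D' : connection M)
      (i : simplex_map N M),
    compact [set: M]%classic ->
    kahler Omega J g ->
    torsion_free D -> torsion_free D' -> dual_connections g D D' ->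
    parallel2 D Omega ->
    isostatistical g D D' i ->
    forall p q : M,
      ((hellinger (i p) (i q))%:E <= geodesic_distance g p q)%E) /\
  (forall (d N : nat) (M : manifold R d.*2.+1) (Omega : tensor2 M)
      (alpha : one_form M) (Theta : endo_field M) (E : vfield M)
      (g : tensor2 M) (D D' : connection M) (i : simplex_map N M),
    compact [set: M]%classic ->
    cokahler Omega alpha Theta E g ->
    torsion_free D -> torsion_free D' -> dual_connections g D D' ->
    parallel2 D Omega -> parallel_vfield D E ->
    isostatistical g D D' i ->
    forall p q : M,
      ((hellinger (i p) (i q))%:E <= geodesic_distance g p q)%E).
Proof.
split=> d N M Omega.
  move=> J g D D' i _ _ _ _ _ _ [_ gF _].
  exact: hellinger_le_geodesic_distance gF.
move=> alpha Theta E g D D' i _ _ _ _ _ _ _ [_ gF _].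
exact: hellinger_le_geodesic_distance gF.
Qed.
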